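(* For every graph $H$ with at least three non-isolated vertices there exist positive constants $c$, $\alpha^-$, and $\alpha^+$ such that $$\alpha^- n^{v(H)} (b+1)^{-e(H)} \leq S(H,n,b) \leq \alpha^+ n^{v(H)} (b+1)^{-e(H)}$$ for all positive integers $n,b$ with $b \leq c\cdot n^{1/m_2(H)}$.
   Context: A biased $(b:1)$ Waiter-Client game $(X,\mathcal F)$ is played in rounds: in each round Waiter offers Client exactly $b+1$ previously unselected elements of the finite board $X$; Client keeps one and Waiter gets the other $b$; if at most $b$ free elements remain, they go to Waiter. The value is the number of winning sets $A\in\mathcal F$ fully claimed by Client at the end under optimal play (Waiter maximizes, Client minimizes). $S(H,n,b)$ is the value of the $(b:1)$ Waiter-Client game on the edge set of $K_n$ whose winning sets are the edge sets of all copies of $H$ in $K_n$. $v(G),e(G)$ are the numbers of vertices and edges, and $m_2(H)=\max\{(e(H')-1)/(v(H')-2) : H'\subseteq H, v(H')\geq 3\}$. *)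

(* Defs.v *)
From mathcomp Require Import all_boot all_order all_algebra.
From mathcomp Require Import reals exp.

Set Implicit Arguments.
Unset Strict Implicit.
Unset Printing Implicit Defensive.

Import Order.TTheory GRing.Theory Num.Theory.

Section Game.
Variables (T : finType) (b : nat) (F : seq {set T}).

(* F is a multiset of winning sets: repetitions count. *)
Definition claimed (C : {set T}) : nat := count (fun A : {set T} => A \subset C) F.

(* Backward induction from the position where Client owns C and the elements
   of X are free.  The fuel k is harmless as soon as #|X| <= k, since every
   round consumes b + 1 >= 1 free elements.  The default size F of the minimum
   is an upper bound of all values, and an offer O is never empty. *)
Fixpoint wc_value_rec (k : nat) (C X : {set T}) : nat :=
  if k is k'.+1 then
    if #|X| <= b then claimed C
    else \max_(O : {set T} | (O \subset X) && (#|O| == b.+1))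
           \big[minn/size F]_(x in O) wc_value_rec k' (x |: C) (X :\: O)
  else claimed C.

Definition wc_value (X : {set T}) : nat := wc_value_rec #|X| set0 X.

End Game.

(* A graph whose vertices are taken from T: vertex set and edge set, an edge
   being the set of its two ends. *)
Definition graph (T : finType) : Type := ({set T} * {set {set T}})%type.

Section Graphs.
Variable T : finType.
Implicit Types G H : graph T.

Definition vertices H : {set T} := H.1.
Definition edges H : {set {set T}} := H.2.

Definition is_graph H : bool :=
  [forall A in edges H, (A \subset vertices H) && (#|A| == 2)].

Definition subgraph G H : bool :=
  [&& is_graph G, vertices G \subset vertices H & edges G \subset edges H].

Definition non_isolated H : {set T} :=
  [set x in vertices H | [exists A in edges H, x \in A]].

Definition isomorphic (U : finType) H (G : graph U) : bool :=
  [exists f : {ffun T -> U},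
    dinjectiveb f (vertices H) &&
    (G == (f @: vertices H, [set f @: (A : {set T}) | A in edges H]))].

(* The default -1 is the least value the ratio can take (since e(G) >= 0 and
   v(G) >= 3), so it does not affect the maximum of a nonempty family. *)
Definition m2 (R : realType) H : R :=
  (\big[Order.max/-1]_(G : {set T} * {set {set T}}
                        | subgraph G H && (3 <= #|vertices G|)%N)
     ((#|edges G|%:R - 1) / (#|vertices G|%:R - 2)))%R.

End Graphs.

Definition complete (n : nat) : graph 'I_n :=
  ([set: 'I_n], [set A : {set 'I_n} | #|A| == 2]).

Definition copies (T U : finType) (H : graph T) (K : graph U) :
    {set {set U} * {set {set U}}} :=
  [set G | subgraph G K && isomorphic H G].

(* One winning set per copy: when H has isolated vertices, distinct copies may
   share their edge set, and they are counted separately. *)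
Definition S_WC (T : finType) (H : graph T) (n b : nat) : nat :=
  wc_value b [seq edges G | G : {set 'I_n} * {set {set 'I_n}} in copies H (complete n)]
    (edges (complete n)).

(* Main.v *)
(* Upper bound: give a copy A none of whose edges Waiter holds the weight
   (b+1)^(number of edges of A owned by Client).  If Client picked uniformly in
   the offer, the expected total weight would not increase, so some pick does
   not increase it; it starts at the number of copies, which is O(n^v(H)), and
   at the end each copy claimed by Client weighs (b+1)^e(H).

   Lower bound: split the vertices of K_n into classes indexed by the vertices
   of H and keep only the copies respecting the classes, so that distinct edges
   of H ("labels") live on disjoint parts of the board.  Waiter plays one label
   after the other.  The condition b <= c n^(1/m2(H)) says that the e(H)-partite
   hypergraph D of copies is spread: with q = b+1 and N = n^2, at most
   K q^(1-|J|) |D| / N copies contain given edges for the labels in J.  While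
   playing a label, Waiter repeatedly offers q elements each lying in at least
   |D|/(4N) alive copies.  As in the container algorithm, a copy is dropped once
   its restriction to some set J of later labels is contained in too many of the
   copies already won; by double counting this drops few copies as long as fewer
   than |D|/(16 K q) copies are won.  The won copies are then again spread, with
   a larger constant K, and constitute a constant fraction of |D|/q; after e(H)
   labels, order |D| q^(-e(H)) copies are completely owned by Client. *)
Require Import Defs.
From mathcomp Require Import all_boot all_order all_algebra.
From mathcomp Require Import reals exp.
From mathcomp Require Import zify lra.

Set Implicit Arguments.
Unset Strict Implicit.
Unset Printing Implicit Defensive.

(** * Single moves and the game value *)

Section Moves.
Variables (X : finType) (b : nat) (F : seq {set X}).
Implicit Types C Y O : {set X}.

Lemma subset_card (Z : {set X}) k : k <= #|Z| ->
  exists2 O : {set X}, O \subset Z & #|O| = k.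
Proof.
move=> kZ; exists [set x in take k (enum Z)].
  apply/subsetP=> x; rewrite inE => /mem_take; by rewrite mem_enum.
rewrite cardsE (card_uniqP _) ?take_uniq ?enum_uniq //.
by rewrite size_takel // -cardE.
Qed.

Lemma bigmin_le k O (f : X -> nat) x :
  x \in O -> \big[minn/k]_(y in O) f y <= f x.
Proof.
rewrite -[\big[_/_]_(_ in O) _]big_filter => xO.
have: x \in [seq y <- index_enum X | y \in O]
  by rewrite mem_filter xO mem_index_enum.
elim: [seq _ <- _ | _] => //= y s IH; rewrite inE big_cons geq_min.
by case/predU1P=> [->|/IH->]; rewrite ?leqnn ?orbT.
Qed.

(** Ensures that the default [size F] of the minimum over an offer never undercuts an actual
    value. *)
Lemma wc_value_le k C Y : wc_value_rec b F k C Y <= size F.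
Proof.
elim: k C Y => [|k IH] C Y /=; first exact: count_size.
case: ifP => _; first exact: count_size.
apply/bigmax_leqP => O /andP[_ /eqP cO].
have /card_gt0P[x xO] : 0 < #|O| by rewrite cO.
exact: leq_trans (bigmin_le _ _ xO) (IH _ _).
Qed.

Lemma waiter_move k C Y O : O \subset Y -> #|O| = b.+1 ->
  exists2 x, x \in O &
    wc_value_rec b F k (x |: C) (Y :\: O) <= wc_value_rec b F k.+1 C Y.
Proof.
move=> OY cO; have /card_gt0P[x0 x0O] : 0 < #|O| by rewrite cO.
pose f x := wc_value_rec b F k (x |: C) (Y :\: O).
have [x xO fmin] := arg_minnP f x0O; exists x => //.
have bY : (#|Y| <= b) = false.
  by apply/negbTE; rewrite -ltnNge -cO subset_leq_card.
rewrite /= bY.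
apply: (bigmax_sup O); first by rewrite OY cO /=.
elim/big_ind: _ => [|m p hm hp|y yO]; first exact: wc_value_le.
  by rewrite leq_min hm hp.
exact: fmin.
Qed.

Lemma client_move k C Y v : b < #|Y| ->
  (forall O, O \subset Y -> #|O| = b.+1 ->
     exists2 x, x \in O & wc_value_rec b F k (x |: C) (Y :\: O) <= v) ->
  wc_value_rec b F k.+1 C Y <= v.
Proof.
move=> bY hO; rewrite /= [#|Y| <= b]leqNgt bY /=.
apply/bigmax_leqP => O /andP[OY /eqP cO].
have [x xO le_v] := hO O OY cO.
exact: leq_trans (bigmin_le _ _ xO) le_v.
Qed.

(** Client's set only grows, so what Client owns counts whatever is offered next; Waiter's analysis
    can stop before the board is exhausted. *)
Lemma claimed_le_wc_value k C Y : claimed F C <= wc_value_rec b F k C Y.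
Proof.
elim: k C Y => [|k IH] C Y //.
have [Yb|bY] := leqP #|Y| b; first by rewrite /= Yb.
have [O OY cO] := subset_card bY.
have [x _] := waiter_move k C OY cO; apply: leq_trans.
apply: leq_trans (IH _ _); apply: sub_count => A AC.
exact: subset_trans AC (subsetUr _ _).
Qed.

End Moves.

(** * Client's side: the weight argument *)

Section ClientStrategy.
Variables (X : finType) (b : nat).
Implicit Types A C Y O : {set X}.

Definition weight C Y A : nat := (A \subset C :|: Y) * b.+1 ^ #|A :&: C|.

(* An offered element x contributes only if A meets the offer at most in x:
   either A misses the offer, or a single x contributes, with an extra factor
   b.+1. *)
Lemma weight_round A C Y O : [disjoint C & Y] -> O \subset Y -> #|O| = b.+1 ->
  \sum_(x in O) weight (x |: C) (Y :\: O) A <= b.+1 * weight C Y A.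
Proof.
move=> dCY OY cO.
have sub x : x \in O -> A \subset (x |: C) :|: (Y :\: O) -> A \subset C :|: Y.
  move=> xO /subset_trans; apply; rewrite !subUset subsetUl sub1set inE.
  by rewrite (subsetP OY _ xO) orbT (subset_trans (subsetDl _ _) (subsetUr _ _)).
have [/eqP AO|] := boolP (A :&: O == set0).
  rewrite -cO -sum_nat_const; apply: leq_sum => x xO.
  have AxC : A :&: (x |: C) = A :&: C.
    apply/setP=> z; rewrite !inE; case: eqP => // ->.
    by have := in_set0 x; rewrite -AO inE xO andbT => ->.
  rewrite /weight AxC leq_mul2r; apply/orP; right.
  by case: (boolP (A \subset (x |: C) :|: _)) => // /(sub _ xO) ->.
case/set0Pn=> z /setIP[zA zO].
rewrite (bigD1 z) //= big1 ?addn0.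
  rewrite /weight mulnCA -expnS.
  apply: leq_mul.
    by case: (boolP (A \subset (z |: C) :|: _)) => // /(sub _ zO) ->.
  apply: leq_pexp2l => //; rewrite (leq_trans _ (_ : #|z |: (A :&: C)| <= _)) //.
    by apply: subset_leq_card; rewrite setIUr setSU // subsetIr.
  by rewrite cardsU1; case: (_ \notin _) => //=; rewrite ?add0n.
move=> x /andP[xO xz]; rewrite /weight.
case: (boolP (A \subset _)) => // /subsetP /(_ z zA).
rewrite !inE zO /= orbF eq_sym (negPf xz) /= => zC.
by have := disjointFr dCY zC; rewrite (subsetP OY _ zO).
Qed.

Lemma wc_value_weight (F : seq {set X}) e k C Y :
  {in F, forall A, #|A| = e} -> [disjoint C & Y] ->
  wc_value_rec b F k C Y * b.+1 ^ e <= \sum_(A <- F) weight C Y A.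
Proof.
(* Serves both ends of the recursion: a claimed set of size [e] weighs exactly [b.+1 ^ e]. *)
move=> Fe; have base D Z : claimed F D * b.+1 ^ e <= \sum_(A <- F) weight D Z A.
  rewrite /claimed -sum1_count big_distrl /= big_mkcond /=.
  rewrite big_seq [leqRHS]big_seq; apply: leq_sum => A AF.
  case: ifP => // AD; rewrite /weight (subset_trans AD (subsetUl _ _)).
  by rewrite (setIidPl AD) Fe.
elim: k C Y => [|k IH] C Y dCY; first exact: base.
have [Yb|bY] := leqP #|Y| b; first by rewrite /= Yb; exact: base.
rewrite -leq_divRL ?expn_gt0 //; apply: client_move => // O OY cO.
(* [f x] is the total weight after Client picks [x]. Its average over the offer is at most the
   present total, so some pick does not increase it. *)
pose f x := \sum_(A <- F) weight (x |: C) (Y :\: O) A.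
have fO : \sum_(x in O) f x <= #|O| * \sum_(A <- F) weight C Y A.
  rewrite exchange_big big_distrr /=; apply: leq_sum => A _.
  by rewrite cO; exact: weight_round.
have [x xO fx] : exists2 x, x \in O & f x <= \sum_(A <- F) weight C Y A.
  apply/exists_inP; apply: contraLR fO; rewrite negb_exists_in => /forall_inP H.
  rewrite -ltnNge -sum_nat_const.
  have /card_gt0P[x0 x0O] : 0 < #|O| by rewrite cO.
  rewrite (bigD1 x0) //= [ltnRHS](bigD1 x0) //= -addSn leq_add //.
    by rewrite ltnNge H.
  by apply: leq_sum => x /andP[xO _]; rewrite ltnW // ltnNge H.
exists x => //; rewrite leq_divRL ?expn_gt0 //; apply: leq_trans (IH _ _ _) fx.
apply/pred0P=> z; rewrite /= !inE; case: eqP => [->|_] /=; first by rewrite xO.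
by case zC: (z \in C) => //=; rewrite (disjointFr dCY zC) andbF.
Qed.

End ClientStrategy.

(** * Waiter's side: spread families and heavy offers *)

Section WaiterStrategy.
Variables (X I L : finType) (b : nat) (F : seq {set X}) (x : L -> I -> X).
Variable N : nat.
Implicit Types (C Y O : {set X}) (D : {set I}) (J R : {set L}).
Local Notation q := b.+1.

Definition agree J g h : bool := [forall e in J, x e h == x e g].

Lemma agree_sym J g h : agree J g h = agree J h g.
Proof. by apply: eq_forallb => e; rewrite eq_sym. Qed.

(** Codegree in [D] of the restriction of [g] to the labels [J]. *)
Definition deg D J g : nat := #|[set h in D | agree J g h]|.

Lemma deg_agree D J g h : agree J g h -> deg D J g = deg D J h.
Proof.
move=> /forall_inP gh; apply: eq_card => i; rewrite !inE; congr (_ && _).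
by apply: eq_forallb_in => e /gh /eqP ->.
Qed.

(* Multiplied through by b.+1, to avoid the exponent #|J| - 1. *)
Definition spread K D R : Prop :=
  forall J g, J \subset R -> J != set0 -> g \in D ->
    deg D J g * (N * q ^ #|J|) <= K * q * #|D|.

Lemma degE D J g : deg D J g = \sum_(h in D) agree J g h.
Proof. by rewrite /deg cardsE -sum1_card big_mkcondr. Qed.

(** Counts from both sides the pairs in [S] times [D1] that agree on [J], each with weight [s]. *)
Lemma double_count (D D1 S : {set I}) J s m d : S \subset D ->
  {in S, forall g, m <= deg D1 J g * s} ->
  {in D1, forall h, deg D J h * s <= d} ->
  #|S| * m <= #|D1| * d.
Proof.
move=> SD mS dD1; rewrite -!sum_nat_const.
apply: (@leq_trans (\sum_(g in S) deg D1 J g * s)); first exact: leq_sum.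
apply: (@leq_trans (\sum_(h in D1) deg D J h * s)); last exact: leq_sum.
rewrite -!big_distrl leq_mul2r; apply/orP; right.
under eq_bigr do rewrite degE; under [leqRHS]eq_bigr do rewrite degE.
rewrite exchange_big /=; apply: leq_sum => h _.
rewrite [leqRHS](big_setID S) /= (setIidPr SD).
apply: leq_trans (leq_addr _ _); apply: leq_sum => g _.
by rewrite agree_sym.
Qed.

Lemma card_fiber_sum (T : finType) (f : T -> X) (D : {set T}) Y :
  {in D, forall g, f g \in Y} -> #|D| = \sum_(y in Y) #|[set g in D | f g == y]|.
Proof.
move=> DY; rewrite -sum1_card (partition_big f (mem Y)) //=.
by apply: eq_bigr => y _; rewrite -sum1_card; apply: eq_bigl => g; rewrite inE.
Qed.

Lemma card_fiber K e D y : spread K D [set e] ->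
  #|[set g in D | x e g == y]| * N <= K * #|D|.
Proof.
move=> spr; have [->|[g]] := set_0Vmem [set g in D | x e g == y].
  by rewrite cards0.
rewrite inE => /andP[gD /eqP gy].
have e0 : [set e] != set0 by apply/set0Pn; exists e; exact: set11.
have := spr [set e] g (subxx _) e0 gD; rewrite cards1 expn1.
have -> : deg D [set e] g = #|[set g in D | x e g == y]|.
  apply: eq_card => h; rewrite !inE -gy; congr (_ && _).
  apply/forall_inP/idP => [/(_ e)|he e']; first by rewrite inE => /(_ (eqxx _)).
  by rewrite inE => /eqP ->.
by rewrite mulnA [K * q * _]mulnAC leq_pmul2r.
Qed.

(** The elements of [Y] in fewer than [#|D| / (4N)] copies of [D'] number at most [N], so they
    account for at most [#|D| / 4] copies. The heavy ones account for at least another quarter; each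
    lies in at most [K * #|D| / N] copies, so there are at least [N / (4K) >= q] of them. *)
Lemma heavy_offer K e D D' Y : 0 < K -> 4 * K * q <= N ->
  0 < #|D| -> D' \subset D -> #|D| <= 2 * #|D'| -> #|Y| <= N ->
  {in D', forall g, x e g \in Y} -> spread K D [set e] ->
  exists O, [/\ O \subset Y, #|O| = q &
    {in O, forall y, #|D| <= 4 * N * #|[set g in D' | x e g == y]|}].
Proof.
move=> K0 KN D0 sD' DD' YN D'Y spr.
have N0 : 0 < N by apply: leq_trans KN; rewrite !muln_gt0 K0.
pose f y := #|[set g in D' | x e g == y]|.
have fK y : f y * N <= K * #|D|.
  apply: leq_trans (card_fiber y spr); rewrite leq_mul2r; apply/orP; right.
  apply/subset_leq_card/subsetP => g.
  by rewrite !inE => /andP[/(subsetP sD') -> ->].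
pose Z := [set y in Y | #|D| <= 4 * N * f y].
have ZY : Z \subset Y by apply/subsetP => y; rewrite inE => /andP[].
suff /subset_card[O OZ cO] : q <= #|Z|.
  exists O; split=> //; first exact: subset_trans OZ ZY.
  by move=> y /(subsetP OZ); rewrite inE => /andP[].
have sumD' : 4 * N * #|D'| <= #|Z| * (4 * K * #|D|) + N * #|D|.
  rewrite (card_fiber_sum D'Y) big_distrr /= (big_setID Z) /= (setIidPr ZY).
  apply: leq_add.
    rewrite -sum_nat_const; apply: leq_sum => y _.
    by rewrite -!mulnA leq_mul2l /= mulnC fK.
  apply: (@leq_trans (\sum_(y in Y :\: Z) #|D|)).
    apply: leq_sum => y; rewrite !inE => /andP[+ yY]; rewrite yY /= -ltnNge.
    exact: ltnW.
  rewrite sum_nat_const leq_mul2r (leq_trans _ YN) ?orbT //.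
  exact: subset_leq_card (subsetDl _ _).
have : N * #|D| <= #|Z| * (4 * K) * #|D|.
  by move: (leq_mul (leqnn (2 * N)) DD') sumD'; nia.
rewrite leq_pmul2r // => NZ; have := leq_trans KN NZ.
by rewrite [leqRHS]mulnC leq_pmul2l // muln_gt0 K0.
Qed.


Lemma card_bigcup_le (T S : finType) (P : pred T) (G : T -> {set S}) :
  #|\bigcup_(i | P i) G i| <= \sum_(i | P i) #|G i|.
Proof.
elim/big_rec2: _ => [|i n A _ le_n]; first by rewrite cards0.
by apply: leq_trans (leq_card_setU _ _) _; rewrite leq_add2l.
Qed.

(** * Playing a single label *)

Section Label.
Variables (e : L) (R : {set L}) (D : {set I}) (K : nat).
Hypotheses (K_gt0 : 0 < K) (KN : 4 * K * q <= N) (D_gt0 : 0 < #|D|).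
Hypothesis spreadD : spread K D (e |: R).
(** The factor [4 * #|{set L}|] pays for a union bound over all [J], leaving at most [q * #|D1| / 4]
    saturated copies. *)
Let M := 4 * #|{set L}| * K.

(* A copy not yet offered for the label e and none of whose restrictions to the
   later labels R is saturated by the won copies D1. *)
Definition alive D1 Y : {set I} :=
  [set g in D | (x e g \in Y) &&
    [forall J : {set L}, (J \subset R) && (J != set0) ==>
      (deg D1 J g * (N * q ^ #|J|) <= M * #|D|)]].

Lemma aliveP D1 Y g : g \in alive D1 Y ->
  [/\ g \in D, x e g \in Y & forall J, J \subset R -> J != set0 ->
      deg D1 J g * (N * q ^ #|J|) <= M * #|D|].
Proof.
rewrite inE => /and3P[gD gY /forallP gJ]; split=> // J JR J0.
by apply: (implyP (gJ J)); rewrite JR J0.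
Qed.

(** A saturated copy agrees on [J] with more than [M * #|D| / (N * q ^ #|J|)] won copies, while by
    spread a won copy agrees with at most [K * q * #|D| / (N * q ^ #|J|)] copies of [D]. *)
Lemma card_saturated D1 J : D1 \subset D -> J \subset R -> J != set0 ->
  4 * #|{set L}| *
    #|[set g in D | M * #|D| < deg D1 J g * (N * q ^ #|J|)]| <= q * #|D1|.
Proof.
move=> sD1 JR J0; set S := [set g in D | _].
have : #|S| * (M * #|D|) <= #|D1| * (K * q * #|D|).
  apply: (@double_count D D1 S J (N * q ^ #|J|)).
  - by apply/subsetP => g; rewrite inE => /andP[].
  - by move=> g; rewrite inE => /andP[_ /ltnW].
  - move=> h /(subsetP sD1) hD; apply: spreadD => //.
    exact: subset_trans JR (subsetUr _ _).
rewrite !mulnA leq_pmul2r // /M => H.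
by rewrite -(leq_pmul2r K_gt0); move: H; lia.
Qed.

(** A copy that is not alive has its [e]-element outside [Y] or is saturated for some [J]. While
    [D1] is small, the former are fewer than [#|D| / 4], the latter fewer than [#|D| / 64]. *)
Lemma card_alive D1 Y : D1 \subset D -> 16 * K * q * #|D1| < #|D| ->
  #|[set g in D | x e g \notin Y]| <= 4 * q * K * #|D1| ->
  #|D| <= 2 * #|alive D1 Y|.
Proof.
move=> sD1 small off.
pose P (J : {set L}) := (J \subset R) && (J != set0).
pose S (J : {set L}) := [set g in D | M * #|D| < deg D1 J g * (N * q ^ #|J|)].
have cover : D \subset alive D1 Y :|: [set g in D | x e g \notin Y] :|:
    \bigcup_(J | P J) S J.
  apply/subsetP => g gD; rewrite !in_setU !inE gD /=.
  case: (x e g \in Y) => //=; rewrite ?orbT // orbF.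
  case: (boolP [forall J, _]) => //= /forallPn[J].
  rewrite negb_imply -ltnNge => /andP[PJ gJ].
  by apply/bigcupP; exists J => //; rewrite inE gD.
have cS : 4 * \sum_(J | P J) #|S J| <= q * #|D1|.
  have L0 : 0 < #|{set L}| by apply/card_gt0P; exists set0.
  rewrite -(leq_pmul2l L0) mulnA [_ * 4]mulnC big_distrr /=.
  apply: (@leq_trans (\sum_(J | P J) q * #|D1|)).
    by apply: leq_sum => J /andP[JR J0]; exact: card_saturated.
  by rewrite sum_nat_const leq_mul2r max_card orbT.
have := subset_leq_card cover.
have [+ _] := leq_card_setU (alive D1 Y :|: [set g in D | x e g \notin Y])
  (\bigcup_(J | P J) S J).
have [+ _] := leq_card_setU (alive D1 Y) [set g in D | x e g \notin Y].
have := card_bigcup_le P S.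
have qK : q * #|D1| <= 4 * q * K * #|D1|.
  rewrite -!mulnA mulnCA leq_mul2l; apply/orP; right.
  by rewrite mulnA leq_pmull // muln_gt0 K_gt0.
lia.
Qed.

(* D1 collects the copies won so far; the last hypothesis says that each won
   copy accounts for at most 4 q K copies spoilt by the offers. *)
Lemma play_label k C Y D1 :
  (forall e' g h, e' \in R -> g \in D -> h \in D -> x e g != x e' h) ->
  #|Y| <= k -> #|Y| <= N -> D1 \subset D ->
  {in D1, forall g, x e g \in C} -> {in D1, forall g, x e g \notin Y} ->
  {in R & D, forall e' g, x e' g \in Y} ->
  (forall J g, J \subset R -> J != set0 ->
     deg D1 J g * (N * q ^ #|J|) <= (M + K) * #|D|) ->
  #|[set g in D | x e g \notin Y]| <= 4 * q * K * #|D1| ->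
  exists k' C' Y' D',
    [/\ wc_value_rec b F k' C' Y' <= wc_value_rec b F k C Y,
        #|Y'| <= k' /\ #|Y'| <= N,
        [/\ C \subset C', D' \subset D & {in D', forall g, x e g \in C'}],
        {in R & D, forall e' g, x e' g \in Y'} &
        spread ((M + K) * (16 * K)) D' R /\ #|D| <= 16 * K * q * #|D'|].
Proof.
move=> part; elim/ltn_ind: k C Y D1 => k IH C Y D1 Yk YN sD1 D1C D1Y RY D1J off.
(* Waiter stops once [D1] is this large: replacing [#|D|] by [16 * K * q * #|D1|] in the degree
   bound gives the new spread constant. *)
have [big|small] := leqP #|D| (16 * K * q * #|D1|).
  exists k, C, Y, D1; split=> //; split=> // J g JR J0 _.
  apply: leq_trans (D1J J g JR J0) _; rewrite -!mulnA leq_mul2l.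
  by apply/orP; right; rewrite !mulnA.
have spr_e : spread K D [set e].
  move=> J g Je; apply: spreadD; apply: subset_trans Je _; exact: subsetUl.
have DY : {in alive D1 Y, forall g, x e g \in Y} by move=> g /aliveP[].
have sD' : alive D1 Y \subset D by apply/subsetP=> g /aliveP[].
have [O [OY cO heavy]] :=
  heavy_offer K_gt0 KN D_gt0 sD' (card_alive sD1 small off) YN DY spr_e.
case: k => [|k] in IH Yk *.
  by have := subset_leq_card OY; rewrite cO ltnNge (leq_trans Yk).
have N0 : 0 < N by apply: leq_trans KN; rewrite !muln_gt0 K_gt0.
have [y yO le_y] := waiter_move F k C OY cO.
pose E := [set g in alive D1 Y | x e g == y].
have yY := subsetP OY y yO.
have cardE : #|D| <= 4 * N * #|E| := heavy y yO.
have sE : E \subset D.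
  by apply/subsetP => g; rewrite inE => /andP[/aliveP[]].
have disj : [disjoint D1 & E].
  apply/pred0P => g /=; apply/negbTE/negP => /andP[gD1].
  by rewrite inE => /andP[_ /eqP gy]; have := D1Y g gD1; rewrite gy yY.
(* Every offered element is heavy, hence an [e]-element of some copy; so the offer takes nothing
   needed for the later labels. *)
have offO z : z \in O -> exists2 g, g \in D & x e g = z.
  move=> zO; have : 0 < #|[set g in alive D1 Y | x e g == z]|.
    by rewrite lt0n; apply: contraTneq (heavy z zO) => ->; rewrite muln0 -ltnNge.
  by case/card_gt0P=> g; rewrite inE => /andP[/aliveP[gD _ _] /eqP <-]; exists g.
have := IH k (ltnSn k) (y |: C) (Y :\: O) (D1 :|: E).
have cDE : #|D1 :|: E| = #|D1| + #|E|.
  by rewrite cardsU (disjoint_setI0 disj) cards0 subn0.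
case.
- have := subset_leq_card OY; rewrite cardsD (setIidPr OY) cO; lia.
- by apply: leq_trans YN; apply/subset_leq_card/subsetDl.
- by rewrite subUset sD1.
- move=> g; rewrite !inE => /orP[/D1C -> |/andP[_ ->] //]; exact: orbT.
- move=> g; rewrite !inE negb_and negbK.
  by case/orP=> [/D1Y -> |/andP[_ /eqP ->]]; rewrite ?yO ?orbT.
- move=> e' g e'R gD; rewrite inE RY // andbT; apply/negP => /offO[h hD].
  by apply/eqP/part.
- move=> J g JR J0.
  have degU : deg (D1 :|: E) J g <= deg D1 J g + #|[set h in E | agree J g h]|.
    apply: leq_trans (leq_card_setU _ _); apply/subset_leq_card/subsetP => h.
    by rewrite !inE andb_orl.
  (* If the degree on [J] grows, some new copy [h] agrees with [g] on [J]. As [h] was alive, the old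
     degree obeys the [M] bound; the new copies also share [y], so spread on [e |: J] bounds their
     number by the [K] term. *)
  have [E0|[h]] := set_0Vmem [set h in E | agree J g h].
    rewrite E0 cards0 addn0 in degU; apply: leq_trans (D1J J g JR J0).
    by rewrite leq_mul2r degU orbT.
  rewrite inE => /andP[]; rewrite inE => /andP[/aliveP[hD _ hJ] /eqP hy] gh.
  have eJ : e \notin J.
    apply/negP => /(subsetP JR) eR; by have := part e h h eR hD hD; rewrite eqxx.
  have le2 : #|[set h in E | agree J g h]| <= deg D (e |: J) h.
    apply/subset_leq_card/subsetP => i.
    rewrite inE [i \in E]inE -andbA => /and3P[/aliveP[iD _ _] /eqP iy gi].
    rewrite inE iD /=; apply/forall_inP => e'; rewrite !inE => /predU1P[->|e'J].
      by rewrite iy hy.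
    by rewrite (eqP (forall_inP gi e' e'J)) (eqP (forall_inP gh e' e'J)).
  have eJ0 : e |: J != set0 by apply/set0Pn; exists e; exact: setU11.
  have := spreadD (setUS [set e] JR) eJ0 hD; rewrite cardsU1 eJ expnS.
  have := hJ J JR J0; rewrite -(deg_agree D1 gh).
  move: degU le2; move: (deg (D1 :|: E) J g) (deg D1 J g) => d1 d2.
  move: #|[set h in E | agree J g h]| => d3.
  move: (deg D _ h) (q ^ #|J|) => d4 Q d12 d34 le_d2 le_d4.
  have {}le_d4 : d4 * (N * Q) <= K * #|D|.
    move: le_d4; rewrite (mulnCA N) (mulnCA d4) (mulnC K) -[leqRHS]mulnA.
    by rewrite leq_pmul2l.
  rewrite mulnDl; apply: leq_trans (leq_add le_d2 le_d4); rewrite -mulnDl.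
  by rewrite leq_mul2r; apply/orP; right; apply: leq_trans d12 _; rewrite leq_add2l.
- have sub : [set g in D | x e g \notin Y :\: O] \subset
      [set g in D | x e g \notin Y] :|: [set g in D | x e g \in O].
    apply/subsetP => g; rewrite !inE negb_and negbK.
    by case: (g \in D) => //=; rewrite orbC.
  (* Each of the [q] offered elements spoils at most [K * #|D| / N] copies, and
     [#|D| <= 4 * N * #|E|]: the newly won copies pay for them. *)
  have offE : #|[set g in D | x e g \in O]| * N <= q * (K * #|D|).
    rewrite (@card_fiber_sum _ (x e) _ O); last by move=> g; rewrite inE => /andP[].
    rewrite big_distrl -cO -sum_nat_const /=; apply: leq_sum => z _.
    apply: leq_trans (card_fiber z spr_e); rewrite leq_mul2r; apply/orP; right.
    by apply/subset_leq_card/subsetP=> g; rewrite !inE -andbA => /and3P[-> _ ->].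
  apply: leq_trans (subset_leq_card sub) _; apply: leq_trans (leq_card_setU _ _) _.
  rewrite cDE mulnDr leq_add // -(leq_pmul2r N0); apply: leq_trans offE _.
  have := leq_mul (leqnn (q * K)) cardE; lia.
move=> k' [C' [Y' [D' [H1 H2 [H3 H4 H5] H6 H7]]]].
exists k', C', Y', D'; split=> //; first exact: leq_trans H1 le_y.
by split=> //; apply: subset_trans H3; exact: subsetUr.
Qed.

End Label.

End WaiterStrategy.

(** * All labels in succession, with their constants *)

Definition grow (l K : nat) : nat := (4 * l * K + K) * (16 * K).

(** Spread constants only grow from label to label, so requiring room for the last one covers every
    label. *)
Fixpoint last_spread (l s K : nat) : nat :=
  if s is s'.+1 then last_spread l s' (grow l K) else K.

Fixpoint loss (l s K : nat) : nat :=
  if s is s'.+1 then 16 * K * loss l s' (grow l K) else 1.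

Lemma grow_ge l K : K <= grow l K.
Proof.
case: K => // K; rewrite /grow -[leqLHS]muln1 leq_mul // ?muln_gt0 //.
exact: leq_addl.
Qed.

Lemma last_spread_ge l s K : K <= last_spread l s K.
Proof. by elim: s K => //= s IH K; apply: leq_trans (grow_ge l K) (IH _). Qed.

Lemma loss_gt0 l s K : 0 < K -> 0 < loss l s K.
Proof.
elim: s K => //= s IH K K0; rewrite !muln_gt0 K0 IH //.
exact: leq_trans K0 (grow_ge l K).
Qed.

Section WaiterValue.
Variables (X I L : finType) (b : nat) (F : seq {set X}) (x : L -> I -> X).
Variable N : nat.
Let l := #|{set L}|.

(** The copies won for one label become the [D] of the next. The last hypothesis converts copies
    owned in all remaining labels into winning sets; it concerns only supersets of [C], so edges won
    for earlier labels may be used. *)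
Lemma waiter_value s (R : {set L}) (D : {set I}) K k (C Y : {set X}) :
  #|R| = s -> 0 < K -> 4 * last_spread l s K * b.+1 <= N ->
  #|Y| <= k -> #|Y| <= N -> spread b x N K D R ->
  (forall e e' g h, e \in R -> e' \in R -> e != e' -> g \in D -> h \in D ->
     x e g != x e' h) ->
  {in R & D, forall e g, x e g \in Y} ->
  (forall (D' : {set I}) (C' : {set X}), D' \subset D -> C \subset C' ->
     {in R & D', forall e g, x e g \in C'} -> #|D'| <= claimed F C') ->
  #|D| <= loss l s K * b.+1 ^ s * wc_value_rec b F k C Y.
Proof.
elim: s R D K k C Y => [|s IH] R D K k C Y cR K0 KN Yk YN spr part RY pay.
  rewrite !mul1n; apply: leq_trans (claimed_le_wc_value _ _ _ _ _).
  by apply: pay => // e g; rewrite (cards0_eq cR) inE.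
have [->|D_gt0] := posnP #|D|; first by [].
have /card_gt0P[e eR] : 0 < #|R| by rewrite cR.
have cR' : #|R :\ e| = s by move: cR; rewrite (cardsD1 e) eR => -[].
have eRE : e |: (R :\ e) = R by rewrite setD1K.
have spr' : spread b x N K D (e |: (R :\ e)) by rewrite eRE.
have KN1 : 4 * K * b.+1 <= N.
  apply: leq_trans KN; rewrite leq_mul2r leq_mul2l /=.
  exact: (last_spread_ge l s.+1 K).
have sR e' : e' \in R :\ e -> e' \in R by rewrite inE => /andP[].
have RY0 : [set g in D | x e g \notin Y] = set0.
  by apply/setP => g; rewrite !inE; case: (boolP (g \in D)) => //= gD; rewrite RY.
have := @play_label X I L b F x N e (R :\ e) D K K0 KN1 D_gt0 spr' k C Y set0.
case=> //.
- move=> e' g h; rewrite inE => /andP[e'e e'R] gD hD.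
  by apply: part => //; rewrite eq_sym; move: e'e; rewrite inE.
- exact: sub0set.
- by move=> g; rewrite inE.
- by move=> g; rewrite inE.
- by move=> e' g /sR; exact: RY.
- move=> J g _ _; have -> : deg x set0 J g = 0; last by [].
  by apply/eqP; rewrite cards_eq0; apply/eqP/setP => h; rewrite !inE.
- by rewrite RY0 cards0.
move=> k' [C' [Y' [D' [le_v [Yk' YN'] [CC' DD' D'C'] RY' [spr1 leD]]]]].
have sD := subsetP DD'.
apply: leq_trans leD _.
have le_D' : #|D'| <=
    loss l s (grow l K) * b.+1 ^ s * wc_value_rec b F k' C' Y'.
  apply: (IH (R :\ e)) => //.
  - exact: leq_trans K0 (grow_ge _ _).
  - by move=> e1 e2 g h /sR e1R /sR e2R e12 /sD gD /sD hD; exact: part.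
  - by move=> e1 g e1R /sD gD; exact: RY'.
  - move=> D2 C2 D2D C'C2 D2C2; apply: pay.
    + exact: subset_trans D2D DD'.
    + exact: subset_trans CC' C'C2.
    + move=> e1 g e1R gD2; have [->|e1e] := eqVneq e1 e.
        by apply: (subsetP C'C2); apply: D'C'; exact: (subsetP D2D).
      by apply: D2C2 => //; rewrite !inE e1e.
rewrite /= expnS.
apply: (@leq_trans (16 * K * b.+1 *
   (loss l s (grow l K) * b.+1 ^ s * wc_value_rec b F k' C' Y'))).
  by rewrite leq_mul2l le_D' orbT.
rewrite !mulnA [_ * b.+1 * loss _ _ _]mulnAC.
by rewrite leq_mul2l le_v orbT.
Qed.

End WaiterValue.

(** * Counting maps *)

Lemma card_familyE (T U : finType) (P : T -> pred U) :
  #|family P| = \prod_u #|P u|.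
Proof. by rewrite card_family foldrE big_image. Qed.

Lemma prod_nat_const_cond (T : finType) (W : {set T}) k (f : T -> nat) :
  (forall u, f u = if u \in W then k else 1) -> \prod_u f u = k ^ #|W|.
Proof.
move=> fE; rewrite -prod_nat_const [RHS]big_mkcond /=.
by apply: eq_bigr => u _; rewrite fE.
Qed.

(** Used with [g] constant to count copies, and with [g] canonical to bound codegrees. *)
Lemma card_ffun_eq_out (T U : finType) (W : {set T}) (g : T -> U) :
  #|[set h : {ffun T -> U} | [forall u, (u \in W) || (h u == g u)]]| = #|U| ^ #|W|.
Proof.
pose P u : pred U := [pred i | (u \in W) || (i == g u)].
have -> : #|[set h : {ffun T -> U} | [forall u, (u \in W) || (h u == g u)]]| =
    #|family P|.
  apply: eq_card => h; rewrite inE.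
  by apply/forallP/familyP => hP u; have := hP u.
rewrite card_familyE; apply: prod_nat_const_cond => u; rewrite /P.
case: (u \in W); first by apply: eq_card => i; rewrite !inE.
by rewrite -(card1 (g u)); apply: eq_card => i; rewrite !inE.
Qed.

(** * Copies of [H] in the complete graph *)

Section Copies.
Variables (T : finType) (H : graph T) (n : nat).
Hypothesis graphH : is_graph H.
Let V := vertices H.

Lemma edge_sub A : A \in edges H -> A \subset V.
Proof. by move/(forall_inP graphH) => /andP[]. Qed.

Lemma edge_card A : A \in edges H -> #|A| = 2.
Proof. by move/(forall_inP graphH) => /andP[_ /eqP]. Qed.

Definition copy (h : {ffun T -> 'I_n}) : graph 'I_n :=
  (h @: V, [set h @: (A : {set T}) | A in edges H]).

Lemma imset_set_inj (U : finType) (h : T -> U) (A B : {set T}) :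
  {in V &, injective h} -> A \subset V -> B \subset V ->
  h @: A = h @: B -> A = B.
Proof.
move=> hinj; suff sub (A' B' : {set T}) : A' \subset V -> B' \subset V ->
    h @: A' = h @: B' -> A' \subset B'.
  by move=> AV BV AB; apply/eqP; rewrite eqEsubset; apply/andP; split; exact: sub.
move=> AV BV AB; apply/subsetP=> u uA.
have : h u \in h @: B' by rewrite -AB imset_f.
case/imsetP=> w wB hw; rewrite (hinj u w) //; first exact: (subsetP AV).
exact: (subsetP BV).
Qed.

Lemma card_copy_edges (h : {ffun T -> 'I_n}) :
  {in V &, injective h} -> #|edges (copy h)| = #|edges H|.
Proof.
move=> hinj; apply: card_in_imset => A B /edge_sub AV /edge_sub BV.
exact: imset_set_inj.
Qed.

Lemma copiesP (G : graph 'I_n) : G \in copies H (complete n) ->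
  exists2 h : {ffun T -> 'I_n}, {in V &, injective h} & G = copy h.
Proof.
rewrite inE => /andP[_ /existsP[h /andP[/dinjectiveP hinj /eqP ->]]].
by exists h.
Qed.

Lemma copy_in_copies (h : {ffun T -> 'I_n}) :
  {in V &, injective h} -> copy h \in copies H (complete n).
Proof.
move=> hinj; have cE (A : {set T}) : A \in edges H -> #|h @: A| = 2.
  move=> AE; rewrite card_in_imset ?edge_card //.
  by apply: sub_in2 hinj; exact/subsetP/edge_sub.
rewrite inE; apply/andP; split; last first.
  by apply/existsP; exists h; rewrite eqxx andbT; apply/dinjectiveP.
apply/and3P; split; last first.
- by apply/subsetP => B /imsetP[A AE ->]; rewrite inE cE.
- exact: subsetT.
- apply/forall_inP => B /imsetP[A AE ->]; rewrite cE // eqxx andbT.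
  exact/imsetS/edge_sub.
Qed.

(** A copy depends only on the values of its embedding on [V], so the others may be frozen at
    [i0]. *)
Lemma card_copies : 0 < n -> #|copies H (complete n)| <= n ^ #|V|.
Proof.
move=> n0; pose i0 := Ordinal n0.
have := card_ffun_eq_out V (fun=> i0); rewrite card_ord => <-.
apply: leq_trans (leq_imset_card copy _); apply/subset_leq_card/subsetP => G.
case/copiesP=> h hinj ->; apply/imsetP.
exists [ffun u => if u \in V then h u else i0].
  by rewrite inE; apply/forallP => u; rewrite ffunE; case: ifP.
congr (_, _).
  by apply: eq_in_imset => u uV; rewrite ffunE uV.
apply: eq_in_imset => A /edge_sub AV.
by apply: eq_in_imset => u uA; rewrite ffunE (subsetP AV).
Qed.

Lemma S_WC_upper b : 0 < n -> S_WC H n b * b.+1 ^ #|edges H| <= n ^ #|V|.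
Proof.
move=> n0; set F := [seq edges G | G in copies H (complete n)].
apply: leq_trans (wc_value_weight _ _ _ _) _.
- move=> A /imageP[G /copiesP[h hinj ->] ->]; exact: card_copy_edges.
- by rewrite -setI_eq0 set0I.
apply: (@leq_trans (\sum_(A <- F) 1)).
  by apply: leq_sum => A _; rewrite /weight setI0 cards0 muln1; case: (A \subset _).
by rewrite sum1_size size_image; exact: card_copies.
Qed.

(* The residue mod #|T| of a vertex of K_n names the class it lies in;
   outside V canonical maps are frozen, so that distinct ones give distinct
   copies. *)
Definition canonical : {set {ffun T -> 'I_n}} :=
  [set h in family (fun u => [pred i : 'I_n |
     if u \in V then i %% #|T| == enum_rank u else i == 0 :> nat])].

Lemma canonicalP (h : {ffun T -> 'I_n}) : reflect
  (forall u, if u \in V then h u %% #|T| = enum_rank u else h u = 0 :> nat)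
  (h \in canonical).
Proof.
rewrite inE; apply: (iffP familyP) => hu u; have := hu u; rewrite inE.
  by case: ifP => _ /eqP.
by case: ifP => _ /eqP.
Qed.

(** The residue of an image recovers the vertex of [H], even across two canonical maps. Hence their
    injectivity, and the disjointness of the board parts of distinct labels. *)
Lemma canonical_rank h u w : h \in canonical -> u \in V ->
  forall g, g \in canonical -> w \in V -> h u = g w -> u = w.
Proof.
move=> /canonicalP/(_ u) hu uV g /canonicalP/(_ w) gw wV huw.
apply/enum_rank_inj/val_inj; move: hu gw; rewrite uV wV => /= <- <-.
by rewrite huw.
Qed.

Lemma canonical_inj h : h \in canonical -> {in V &, injective h}.
Proof. by move=> hc u w uV wV /(canonical_rank hc uV hc wV). Qed.

Lemma canonical_imset g h (A B : {set T}) : g \in canonical ->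
  h \in canonical -> A \subset V -> B \subset V -> g @: A \subset h @: B ->
  forall u, u \in A -> u \in B /\ g u = h u.
Proof.
move=> gc hc AV BV sAB u uA; have uV := subsetP AV u uA.
have /imsetP[w wB guw] := subsetP sAB _ (imset_f g uA).
have uw := canonical_rank gc uV hc (subsetP BV w wB) guw; subst w.
by split.
Qed.

Lemma canonical_eq g h : g \in canonical -> h \in canonical ->
  {in V, g =1 h} -> g = h.
Proof.
move=> /canonicalP gc /canonicalP hc gh; apply/ffunP => u.
have [/gh //|uV] := boolP (u \in V); apply: val_inj.
by have := gc u; have := hc u; rewrite (negPf uV) /= => -> ->.
Qed.

Lemma copy_inj : {in canonical &, injective copy}.
Proof.
move=> g h gc hc [gh _]; apply: canonical_eq => // u uV.
by have [] := canonical_imset gc hc (subxx V) (subxx V) _ uV; rewrite ?gh.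
Qed.

(** The class of [u] contains [j * #|T| + enum_rank u] for every [j < n %/ #|T|]. *)
Lemma card_canonical : 0 < n -> (n %/ #|T|) ^ #|V| <= #|canonical|.
Proof.
move=> n0; rewrite cardsE card_familyE -prod_nat_const big_mkcond /=.
apply: leq_prod => u _; case: (boolP (u \in V)) => uV; last first.
  by apply/card_gt0P; exists (Ordinal n0); rewrite unfold_in.
have jn (j : 'I_(n %/ #|T|)) : j * #|T| + enum_rank u < n.
  apply: leq_trans (leq_trunc_div n #|T|).
  apply: (@leq_trans (j.+1 * #|T|)); last by rewrite leq_mul2r ltn_ord orbT.
  by rewrite mulSn addnC ltn_add2r.
pose f j : 'I_n := Ordinal (jn j).
have T0 : 0 < #|T| by apply/card_gt0P; exists u.
have finj : injective f.
  by move=> i j [] /addIn /eqP; rewrite eqn_pmul2r // => /eqP /val_inj.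
apply: (@leq_trans #|f @: setT|); first by rewrite card_imset // cardsT card_ord.
apply/subset_leq_card/subsetP => i /imsetP[j _ ->].
by rewrite unfold_in /= modnMDl modn_small.
Qed.

(** Canonical maps with the same image of an edge agree at both its ends, so only the vertices
    outside [cover J] remain free. *)
Lemma deg_canonical (J : {set {set T}}) h : J \subset edges H ->
  h \in canonical ->
  deg (fun (A : {set T}) (g : {ffun T -> 'I_n}) => g @: A) canonical J h
    <= n ^ (#|V| - #|cover J|).
Proof.
move=> JE hc; have JV : cover J \subset V.
  by apply/bigcupsP => A /(subsetP JE) /edge_sub.
have -> : #|V| - #|cover J| = #|V :\: cover J| by rewrite cardsD (setIidPr JV).
have := card_ffun_eq_out (V :\: cover J) h; rewrite card_ord => <-.
apply/subset_leq_card/subsetP => g; rewrite !inE => /andP[gF /forall_inP gJ].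
have gc : g \in canonical by rewrite inE.
apply/forallP => u; rewrite !inE.
have [uV|uV] := boolP (u \in V); last first.
  move/canonicalP/(_ u): gc; move/canonicalP/(_ u): hc.
  rewrite (negPf uV) => h0 g0; apply/orP; right.
  by apply/eqP/val_inj; rewrite /= h0 g0.
have [/bigcupP[A AJ uA]|//] := boolP (u \in cover J).
have AV := edge_sub (subsetP JE A AJ).
have [|_ ->] := canonical_imset gc hc AV AV _ uA; last exact: eqxx.
by rewrite (eqP (gJ A AJ)).
Qed.

Lemma S_WC_lower b : let t := #|T| in let l := #|{set {set T}}| in
  let K := (2 * t) ^ #|V| in let e := #|edges H| in
  0 < t -> t <= n ->
  (forall J : {set {set T}}, J \subset edges H -> J != set0 ->
     b.+1 ^ #|J| * n ^ 2 <= b.+1 * n ^ #|cover J|) ->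
  4 * last_spread l e K * b.+1 <= n ^ 2 ->
  n ^ #|V| <= K * (loss l e K * b.+1 ^ e) * S_WC H n b.
Proof.
move=> t l K e t0 tn dens KN.
have n0 : 0 < n := leq_trans t0 tn.
(* Rounding costs at most a factor two because [t <= n]; this is the source of [K = (2t)^v(H)]. *)
have n2t : n <= 2 * t * (n %/ t).
  have := divn_eq n t; have := ltn_pmod n t0.
  have : 0 < n %/ t by rewrite divn_gt0.
  by move: (n %/ t) (n %% t) => d r; nia.
have nV : n ^ #|V| <= K * #|canonical|.
  apply: (@leq_trans ((2 * t * (n %/ t)) ^ #|V|)).
    by case: #|V| => // v; rewrite leq_exp2r.
  by rewrite expnMn leq_mul2l card_canonical ?orbT.
apply: (leq_trans nV); rewrite -mulnA leq_mul2l; apply/orP; right.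
have cY : #|edges (complete n)| <= n ^ 2.
  by rewrite card_draws card_ord; case: n => // m; rewrite bin2 /=; nia.
have canE (A : {set T}) h : A \in edges H -> h \in canonical ->
    h @: A \in edges (complete n).
  move=> AE hc; rewrite inE card_in_imset ?edge_card //.
  apply: sub_in2 (canonical_inj hc); exact/subsetP/edge_sub.
rewrite /S_WC /wc_value.
apply: (@waiter_value _ {ffun T -> 'I_n} {set T} b _ (fun A h => h @: A) (n ^ 2)
  e (edges H)) => //.
- by rewrite expn_gt0 muln_gt0 t0.
- move=> J h JE J0 hc.
  apply: leq_trans (leq_mul (deg_canonical JE hc) (leqnn _)) _.
  have JV : #|cover J| <= #|V|.
    by apply/subset_leq_card/bigcupsP => A /(subsetP JE) /edge_sub.
  (* By [dens] the powers of [n] recombine to [n ^ #|V|], which is at most [K * #|canonical|]: the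
     canonical maps are spread with constant [K]. *)
  rewrite [n ^ 2 * _]mulnC; apply: leq_trans (leq_mul (leqnn _) (dens J JE J0)) _.
  rewrite mulnCA -expnD subnK // mulnAC [leqLHS]mulnC leq_mul2r.
  apply/orP; right; exact: nV.
- move=> A B g h AE BE AB gc hc; apply: contraNneq AB => gh.
  rewrite eqEsubset; apply/andP; split; apply/subsetP => u uA.
    by have [] := canonical_imset gc hc (edge_sub AE) (edge_sub BE) _ uA; rewrite ?gh.
  by have [] := canonical_imset hc gc (edge_sub BE) (edge_sub AE) _ uA; rewrite ?gh.
(* Winning sets are counted per copy and distinct canonical maps give distinct copies, so each map
   in [D] contributes one. *)
move=> D C DC _ DE; rewrite /claimed count_map.
have := card_in_imset (sub_in2 (subsetP DC) copy_inj) => <-.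
rewrite -size_filter -(card_uniqP _); last exact: filter_uniq (enum_uniq _).
apply/subset_leq_card/subsetP => G /imsetP[h hD ->].
have hc := subsetP DC h hD.
rewrite mem_filter mem_enum /= copy_in_copies; last exact: canonical_inj.
rewrite andbT; apply/subsetP => B /imsetP[A AE ->]; exact: DE.
Qed.

End Copies.

Import Order.TTheory GRing.Theory Num.Theory.

(** * From the bound on [b] to the spread condition *)

Section Density.
Variables (R : realType) (T : finType) (H : graph T).
Hypothesis graphH : is_graph H.

Lemma card_cover_ge3 (J : {set {set T}}) :
  J \subset edges H -> 1 < #|J| -> 2 < #|cover J|.
Proof.
move=> JE /card_gt1P[A [B [AJ BJ AB]]].
have cA := edge_card graphH (subsetP JE A AJ).
have cB := edge_card graphH (subsetP JE B BJ).
apply: (@leq_trans #|A :|: B|); last first.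
  apply: subset_leq_card; rewrite subUset; apply/andP.
  by split; apply/subsetP => u uA; apply/bigcupP; [exists A | exists B].
rewrite ltnNge; apply: contra AB => AB2.
have /eqP -> : A == A :|: B by rewrite eqEcard subsetUl cA.
by rewrite eq_sym eqEcard subsetUr cB.
Qed.

Lemma card_edges_gt1 : 3 <= #|non_isolated H| -> 1 < #|edges H|.
Proof.
have sub : non_isolated H \subset cover (edges H).
  apply/subsetP => u; rewrite inE => /andP[_ /exists_inP[A AE uA]].
  by apply/bigcupP; exists A.
have [le_cov _] := leq_card_cover (edges H).
move=> /leq_trans/(_ (subset_leq_card sub))/leq_trans/(_ le_cov).
rewrite (eq_bigr (fun=> 2)) => [|A /(edge_card graphH) //].
by rewrite sum_nat_const; lia.
Qed.

Local Open Scope ring_scope.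

(** [(cover J, J)] is one of the subgraphs in the maximum. *)
Lemma density_le_m2 (J : {set {set T}}) :
  J \subset edges H -> (2 < #|cover J|)%N ->
  (#|J|%:R - 1) / (#|cover J|%:R - 2) <= m2 R H.
Proof.
move=> JE cJ; rewrite /m2.
have /= := @le_bigmax_cond _ R _ (-1) (cover J, J)
  (fun G : {set T} * {set {set T}} => subgraph G H && (3 <= #|vertices G|)%N)
  (fun G => (#|edges G|%:R - 1) / (#|vertices G|%:R - 2)).
apply; rewrite cJ andbT; apply/and3P; split=> //=.
  apply/forall_inP => A /= AJ.
  rewrite (edge_card graphH) ?(subsetP JE) // eqxx andbT.
  by apply/subsetP => u uA; apply/bigcupP; exists A.
by apply/bigcupsP => A /(subsetP JE) /(edge_sub graphH).
Qed.

(** Two edges span at most four vertices, giving the ratio [(2 - 1) / (4 - 2)]. *)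
Lemma m2_ge_half : (3 <= #|non_isolated H|)%N -> 1 / 2 <= m2 R H.
Proof.
move=> /card_edges_gt1 /subset_card[J JE cJ].
have cov3 : (2 < #|cover J|)%N by apply: card_cover_ge3; rewrite ?cJ.
apply: le_trans (density_le_m2 JE cov3); rewrite cJ.
have [cov4 _] := leq_card_cover J.
rewrite (eq_bigr (fun=> 2%N)) in cov4;
  last by move=> A /(subsetP JE) /(edge_card graphH).
rewrite sum_nat_const cJ in cov4.
have cov3R : 3%:R <= #|cover J|%:R :> R by rewrite ler_nat.
have cov4R : #|cover J|%:R <= 4%:R :> R by rewrite ler_nat.
rewrite ler_pdivlMr; lra.
Qed.

(** Equality holds for a single edge. Otherwise raise [q <= n^(1/m2)] to the power [#|J| - 1], which
    is at most [m2 * (#|cover J| - 2)]. *)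
Lemma edges_density (n q : nat) (J : {set {set T}}) :
  (3 <= #|non_isolated H|)%N -> (0 < n)%N ->
  q%:R <= n%:R `^ (1 / m2 R H) ->
  J \subset edges H -> J != set0 ->
  (q ^ #|J| * n ^ 2 <= q * n ^ #|cover J|)%N.
Proof.
move=> H3 n0 qn JE J0; have m_half := m2_ge_half H3.
have m_gt0 : 0 < m2 R H by lra.
have [J1|J1] := leqP #|J| 1.
  have /cards1P[A JA] : #|J| == 1%N by rewrite eqn_leq J1 card_gt0.
  have AE : A \in edges H by apply: (subsetP JE); rewrite JA set11.
  by rewrite JA cover1 cards1 (edge_card graphH).
have cov3 := card_cover_ge3 JE J1.
rewrite -(prednK (ltnW J1)) expnS -mulnA leq_mul2l; apply/orP; right.
rewrite -(subnK (ltnW cov3)) expnD leq_mul2r; apply/orP; right.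
rewrite -(ler_nat R) !natrX.
apply: (@le_trans _ _ ((n%:R `^ (1 / m2 R H)) ^+ #|J|.-1)).
  by rewrite lerXn2r ?nnegrE ?powR_ge0.
rewrite -powR_mulrn ?powR_ge0 // -powRrM -powR_mulrn //.
apply: ler_powR; first by rewrite ler1n.
have := density_le_m2 JE cov3.
have cov3R : 3%:R <= #|cover J|%:R :> R by rewrite ler_nat.
rewrite ler_pdivrMr; last by lra.
rewrite natrB ?(ltnW cov3) // -subn1 natrB 1?ltnW // => dens.
by rewrite div1r mulrC ler_pdivrMr // mulrC.
Qed.

End Density.

(** * Choice of the constants *)

Local Open Scope ring_scope.

Theorem theorem1p6 (R : realType) (T : finType) (H : graph T)
    (graphH : is_graph H) (H_ge3 : (3 <= #|non_isolated H|)%N) :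
  exists c alpha_minus alpha_plus : R,
    [/\ 0 < c, 0 < alpha_minus, 0 < alpha_plus &
      forall n b : nat, (0 < n)%N -> (0 < b)%N ->
        b%:R <= c * n%:R `^ (1 / m2 R H) ->
        alpha_minus * n%:R ^+ #|vertices H| * b.+1%:R ^- #|edges H| <= (S_WC H n b)%:R
          <= alpha_plus * n%:R ^+ #|vertices H| * b.+1%:R ^- #|edges H|].
Proof.
pose t := #|T|; pose l := #|{set {set T}}|; pose K := ((2 * t) ^ #|vertices H|)%N.
pose e := #|edges H|; pose Kf := last_spread l e K; pose B := (K * loss l e K)%N.
have t_gt0 : (0 < t)%N.
  by apply: leq_trans (max_card (mem (non_isolated H))); apply: leq_trans H_ge3.
have K_gt0 : (0 < K)%N by rewrite expn_gt0 muln_gt0 t_gt0.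
have Kf_gt0 : (0 < Kf)%N := leq_trans K_gt0 (last_spread_ge l e K).
have B_gt0 : (0 < B)%N by rewrite muln_gt0 K_gt0 loss_gt0.
(* With [d * b <= n ^ 2], the factor [t ^ 2] forces [t <= n], and [8 * Kf] gives
   [4 * Kf * b.+1 <= n ^ 2] since [b.+1 <= 2 * b]. *)
pose d := (8 * Kf * t ^ 2)%N.
have d_gt0 : 0 < d%:R :> R by rewrite ltr0n !muln_gt0 Kf_gt0 t_gt0.
have BR_gt0 : 0 < B%:R :> R by rewrite ltr0n.
exists d%:R^-1, B%:R^-1, 1; split; rewrite ?invr_gt0 //.
move=> n b n_gt0 b_gt0; set p := n%:R `^ _ => bp.
have m_half : 1 / 2 <= m2 R H := m2_ge_half R graphH H_ge3.
have m_gt0 : 0 < m2 R H by lra.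
(* The exponent [1 / m2 R H] is at most 2. *)
have p_le : p <= n%:R ^+ 2.
  rewrite -powR_mulrn //; apply: ler_powR; first by rewrite ler1n.
  by rewrite ler_pdivrMr //; lra.
have dbp : (d * b)%:R <= p.
  by move: bp; rewrite mulrC ler_pdivlMr // mulrC natrM.
have dbn : (d * b <= n ^ 2)%N by rewrite -(ler_nat R) natrX (le_trans dbp).
have d_ge : (8 * Kf <= d)%N by rewrite leq_pmulr // expn_gt0 t_gt0.
have qb : (b.+1 <= 2 * b)%N by lia.
have qp : b.+1%:R <= p.
  apply: le_trans dbp; rewrite ler_nat; apply: leq_trans qb _.
  by rewrite leq_mul2r; lia.
have tn : (t <= n)%N.
  rewrite -(@leq_exp2r t n 2) //; apply: leq_trans dbn; rewrite -mulnA mulnCA.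
  by rewrite leq_pmulr // !muln_gt0 Kf_gt0.
have KN : (4 * Kf * b.+1 <= n ^ 2)%N.
  apply: leq_trans dbn; apply: leq_trans (leq_mul d_ge (leqnn b)).
  by apply: leq_trans (leq_mul (leqnn _) qb) _; lia.
have q_gt0 : 0 < b.+1%:R ^+ e :> R by rewrite exprn_gt0 // ltr0n.
apply/andP; split.
  have := S_WC_lower graphH t_gt0 tn
    (fun J => edges_density graphH H_ge3 n_gt0 qp) KN.
  rewrite mulnA -/B -(ler_nat R) 2!natrM !natrX => lower.
  by rewrite ler_pdivrMr // ler_pdivrMl // mulrA mulrAC.
have := S_WC_upper graphH b n_gt0.
by rewrite -(ler_nat R) natrM !natrX mul1r ler_pdivlMr.
Qed.
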